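(* Let $M\in\mathbb{N}^{m\times m}$. Then, for all $i,j\in\{1,\ldots,m\}$ and all $r\in\{0,\ldots,\mathsf{p}(M)-1\}$, either $(M^{\mathsf{p}(M)n+r})_{i,j}=0$ for all sufficiently large $n$, or there exist $\lambda\in\mathrm{Spec}(M^{\mathsf{p}(M)})\cap\mathbb{R}_{\ge 1}$ and $d\in\mathbb{N}$ such that $(M^{\mathsf{p}(M)n+r})_{i,j}=\Theta(n^d\lambda^n)$ (as $n\to\infty$).
   Context: $\mathbb{N}=\{0,1,2,\ldots\}$. A non-negative square matrix $P$ is primitive if there is a positive integer $k$ such that all entries of $P^k$ are positive. For a non-negative square matrix $M$, $\mathsf{p}(M)$ denotes the least positive integer $p$ for which there exists a permutation matrix $T$ such that $T^{-1}M^pT$ is an upper (or lower) block triangular matrix in which each square block on the diagonal is either primitive or the $1\times1$ zero matrix $(0)$ (it is a classical fact that such a $p$ exists). $\mathrm{Spec}(M)$ is the multiset of (complex) eigenvalues of $M$. For non-negative sequences, $a_n=\Theta(b_n)$ means that there exist constants $c,C>0$ such that $c\,b_n\le a_n\le C\,b_n$ for all sufficiently large $n$. *)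

(* Defs.v *)
From mathcomp Require Import all_boot all_order all_algebra all_fingroup.
From mathcomp Require Import boolp.

Set Implicit Arguments.
Unset Strict Implicit.
Unset Printing Implicit Defensive.

Import Order.TTheory GRing.Theory Num.Theory.

Local Open Scope ring_scope.

Definition primitive (n : nat) (P : 'M[nat]_n) : Prop :=
  exists2 k, (0 < k)%N & forall i j, (0 < (P ^+ k) i j)%N.

Definition block_upper_triangular (k : nat) (d : 'I_k -> nat)
    (B : 'M[nat]_(\sum_a d a)) : Prop :=
  forall a b : 'I_k, (b < a)%N -> submxblock B a b = 0.

Definition block_lower_triangular (k : nat) (d : 'I_k -> nat)
    (B : 'M[nat]_(\sum_a d a)) : Prop :=
  forall a b : 'I_k, (a < b)%N -> submxblock B a b = 0.

(* The a-th diagonal block has size d a; blocks are required to be nonempty.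
   [castmx] only transports B along m = \sum_a d a. *)
Definition primitive_block_form (m : nat) (B : 'M[nat]_m) : Prop :=
  exists (k : nat) (d : 'I_k -> nat) (e : m = (\sum_a d a)%N),
    let B' := castmx (e, e) B in
    [/\ forall a, (0 < d a)%N,
        block_upper_triangular B' \/ block_lower_triangular B'
      & forall a, primitive (submxblock B' a a) \/
                  (d a = 1%N /\ submxblock B' a a = 0)].

(* The permutation matrix T is [perm_mx s]; its inverse is [perm_mx s^-1]
   (nat has no inverses, so [invmx] is not available here). *)
Definition is_period (m : nat) (M : 'M[nat]_m) (p : nat) : Prop :=
  (0 < p)%N /\
  exists s : 'S_m,
    primitive_block_form (perm_mx s^-1 *m M ^+ p *m perm_mx s).

Section PeriodExists.
Variables (m : nat) (M : 'M[nat]_m).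

Let supp (A : 'M[nat]_m) : 'M[bool]_m := \matrix_(i, j) (0 < A i j)%N.

Let mul_gt0 (A B : 'M[nat]_m) i j :
  (0 < (A * B)%R i j)%N = [exists l, (0 < A i l)%N && (0 < B l j)%N].
Proof.
rewrite mxE lt0n.
rewrite -[X in X != _]/(\sum_l A i l * B l j)%N.
rewrite sum_nat_eq0 negb_forall; apply: eq_existsb => l /=.
by rewrite -lt0n muln_gt0.
Qed.

Let suppM A B A' B' : supp A = supp A' -> supp B = supp B' ->
  supp (A * B) = supp (A' * B').
Proof.
move=> /matrixP eA /matrixP eB; apply/matrixP => i j; rewrite [LHS]mxE [RHS]mxE !mul_gt0.
apply: eq_existsb => l; move: (eA i l) (eB l j); by rewrite !mxE => -> ->.
Qed.

Let supp_idem : exists2 p, (0 < p)%N & supp (M ^+ p * M ^+ p) = supp (M ^+ p).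
Proof.
have [a [c [a0 c0 ac]]] : exists a c, [/\ (0 < a)%N, (0 < c)%N &
    supp (M ^+ (a + c)) = supp (M ^+ a)].
  pose f (i : 'I_(#|'M[bool]_m|.+1)) := supp (M ^+ i.+1).
  have /injectivePn [x [y xy fxy]] : ~~ injectiveb f.
    apply/negP => /injectiveP /leq_card; by rewrite card_ord ltnn.
  wlog lt_xy : x y xy fxy / (x < y)%N.
    move=> H; case: (ltngtP x y) => [|h|/val_inj] ; first exact: H.
      by apply: (H y x) => //; rewrite eq_sym.
    by move/eqP; rewrite (negbTE xy).
  exists x.+1, (y - x)%N; split; rewrite ?subn_gt0 //.
  by rewrite addSn subnKC ?(ltnW lt_xy).
have step n t : (a <= n)%N -> supp (M ^+ (n + t * c)) = supp (M ^+ n).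
  move=> an; elim: t => [|t IH]; first by rewrite mul0n addn0.
  rewrite -[RHS]IH.
  have -> : (n + t.+1 * c = (a + c) + (n - a + t * c))%N.
    by rewrite mulSn -{1}(subnKC an) -!addnA; congr (_ + _)%N; rewrite addnCA.
  have -> : (n + t * c = a + (n - a + t * c))%N by rewrite addnA subnKC.
  by rewrite !exprD; apply: suppM => //; rewrite -exprD.
exists (a * c)%N; first by rewrite muln_gt0 a0.
by rewrite -exprD step // leq_pmulr.
Qed.

Lemma period_exists : exists p, is_period M p.
Proof.
have [p p0 /matrixP idem] := supp_idem.
exists p; split => //; set N := M ^+ p in idem *.
pose E i j := (0 < N i j)%N.
have Etr i j l : E i j -> E j l -> E i l.
  move=> ij jl; move: (idem i l); rewrite [LHS]mxE [RHS]mxE mul_gt0 /E => <-.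
  by apply/existsP; exists j; apply/andP.
pose C i := [set j | (j == i) || E i j].
have CP i j : C i = C j -> i != j -> E i j.
  move=> /setP eC ij; have := eC j; rewrite !inE eqxx /= => /orP[|//].
  by rewrite eq_sym (negbTE ij).
have CS i j : E i j -> C j \subset C i.
  move=> ij; apply/fintype.subsetP => l; rewrite !inE => /orP[/eqP->|jl].
    by rewrite ij orbT.
  by rewrite (Etr _ _ _ ij jl) orbT.
pose le (X Y : {set 'I_m}) := (#|Y| <= #|X|)%N.
pose rs := sort le (undup (codom C)).
have rs_uniq : uniq rs by rewrite sort_uniq undup_uniq.
have rs_mem i : C i \in rs by rewrite mem_sort mem_undup codom_f.
have le_tr : transitive le by move=> x y z xy yz; exact: leq_trans yz xy.
have rs_sorted : sorted le rs by apply: sort_sorted => x y; exact: leq_total.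
pose k := size rs.
pose r (a : 'I_k) := tnth (in_tuple rs) a.
have r_inj : injective r by apply/tuple_uniqP.
pose cls a := [set i | C i == r a].
pose d (a : 'I_k) := #|cls a|.
pose g (x : 'I_(\sum_a d a)) : 'I_m := enum_val (tagnat.sig2 x).
have gC x : C (g x) = r (tagnat.sig1 x).
  by have := enum_valP (tagnat.sig2 x); rewrite inE => /eqP.
have g_inj : injective g.
  move=> x y gxy; have sxy : tagnat.sig1 x = tagnat.sig1 y.
    by apply: r_inj; rewrite -!gC gxy.
  apply: tagnat.sig_inj; rewrite !tagnat.sigE12.
  move: (gxy); rewrite /g; move: (tagnat.sig2 x) (tagnat.sig2 y).
  rewrite sxy => u v; by move/enum_val_inj ->.
have dE : (\sum_a d a = m)%N.
  rewrite -[RHS]card_ord -sum1_card /d.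
  under eq_bigr do rewrite -sum1_card.
  rewrite (exchange_big_dep xpredT) //=; apply: eq_bigr => i _.
  have /seq_tnthP[a ra] := rs_mem i.
  rewrite (big_pred1 a) // => b; rewrite inE.
  by rewrite ra -/(r a) (inj_eq r_inj) eq_sym.
pose e := esym dE.
have h_inj : injective (fun i : 'I_m => g (cast_ord e i)).
  by move=> i j /g_inj /cast_ord_inj.
pose s : 'S_m := (perm h_inj)^-1%g.
have BE x y : castmx (e, e) (perm_mx s^-1 *m N *m perm_mx s) x y = N (g x) (g y).
  rewrite castmxE /= -row_permE -[s in perm_mx s]invgK -col_permE !mxE /=.
  by rewrite invgK !permE /= !cast_ordKV.
exists s, k, d, e; set B := castmx _ _ in BE *.
have subE a b u v : submxblock B a b u v =
    N (g (tagnat.Rank a u)) (g (tagnat.Rank b v)) by rewrite !mxE BE.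
have gRC a u : C (g (tagnat.Rank a u)) = r a by rewrite gC tagnat.Rank1K.
split.
- move=> a; have := mem_tnth a (in_tuple rs).
  rewrite -/(r a) mem_sort mem_undup => /codomP[i ri].
  by apply/card_gt0P; exists i; rewrite inE ri.
- left=> a b ba; apply/matrixP => u v; rewrite subE [RHS]mxE.
  apply/eqP; rewrite -leqn0 leqNgt; apply/negP => Eab.
  have sub := CS _ _ Eab; rewrite !gRC in sub.
  have : le (r b) (r a).
    rewrite /r !(tnth_nth set0) /=.
    by apply: (sorted_ltn_nth le_tr) => //; rewrite inE.
  rewrite /le => ab; have /eqP/r_inj eab : r b == r a by rewrite eqEcard sub.
  by move: ba; rewrite eab ltnn.
- move=> a.
  have CEa u v : C (g (tagnat.Rank a u)) = C (g (tagnat.Rank a v)) by rewrite !gRC.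
  have [/existsP[u Eu]|/existsPn nE] :=
    boolP [exists u, E (g (tagnat.Rank a u)) (g (tagnat.Rank a u))].
    left; exists 1%N => // v w; rewrite expr1 subE.
    have Evu : E (g (tagnat.Rank a v)) (g (tagnat.Rank a u)).
      by have [<-//|ne] := eqVneq (g (tagnat.Rank a u)) (g (tagnat.Rank a v));
         apply: CP => //; rewrite eq_sym.
    apply: Etr Evu _.
    by have [<-//|ne] := eqVneq (g (tagnat.Rank a u)) (g (tagnat.Rank a w));
       apply: CP.
  have one u v : u = v :> 'I_(d a).
    apply/eqP; apply: contraT => uv; have := nE u.
    have guv : g (tagnat.Rank a u) != g (tagnat.Rank a v).
      apply: contra_neq uv => /g_inj /eqP; rewrite -val_eqE tagnat.eq_Rank.
      by case/andP => _ /eqP /val_inj.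
    rewrite (Etr _ (g (tagnat.Rank a v))) //; apply: CP => //.
    by rewrite eq_sym.
  right; split.
    have : (0 < d a)%N.
      have := mem_tnth a (in_tuple rs).
      rewrite -/(r a) mem_sort mem_undup => /codomP[i ri].
      by apply/card_gt0P; exists i; rewrite inE ri.
    move=> d0; apply/eqP; rewrite eqn_leq d0 andbT leqNgt; apply/negP => d1.
    by have /(congr1 val) := one (Ordinal d0) (Ordinal d1).
  apply/matrixP => u v; rewrite (one u v) subE [RHS]mxE.
  by apply/eqP; rewrite -leqn0 leqNgt; exact: nE.
Qed.

End PeriodExists.

Lemma period_existsb (m : nat) (M : 'M[nat]_m) : exists p, `[< is_period M p >].
Proof. by have [p /asboolP] := period_exists M; exists p. Qed.

Definition period (m : nat) (M : 'M[nat]_m) : nat :=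
  ex_minn (period_existsb M).

(* Main.v *)
(* Put P = M^p with p = period M.  A class of P (a strongly connected component
   of its graph) is either acyclic or carries a primitive block B; by
   Perron-Frobenius B has a positive left eigenvector, whose eigenvalue l >= 1 is
   an eigenvalue of P, and the entries of B^n are Theta(l^n).  A path from i to a
   vertex outside the class of i has a unique edge along which it leaves that
   class, so the entries of P^n are finite sums of convolutions of entries of
   powers of smaller pieces.  Sequences that vanish eventually or are
   Theta(n^d l^n) with l >= 1 in a given set are stable under sums and
   convolutions: the dominant factor wins, and for equal bases d and e give
   d + e + 1.  The entries of P^n M^r are sums of such sequences. *)

Require Import Defs.
From mathcomp Require Import all_boot all_order all_algebra all_fingroup.
From mathcomp Require Import all_classical all_reals all_analysis.
From mathcomp Require Import complex.
From mathcomp Require Import zify ring lra.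

Set Implicit Arguments.
Unset Strict Implicit.
Unset Printing Implicit Defensive.

Import Order.TTheory GRing.Theory Num.Theory.
Import numFieldNormedType.Exports.

Local Open Scope classical_set_scope.
Local Open Scope ring_scope.

Section Growth.
Variable R : realType.
Implicit Types (f g : nat -> nat) (l q : R) (d e : nat).

(* [n.+1] rather than [n], so that the weight is positive also at [n = 0]. *)
Definition weight d l (n : nat) : R := n.+1%:R ^+ d * l ^+ n.

Definition dominated f l d :=
  exists C : R, forall n, (f n)%:R <= C * weight d l n.

Definition theta f l d :=
  dominated f l d /\
  exists2 c : R, 0 < c &
    exists N, forall n, (N <= n)%N -> c * weight d l n <= (f n)%:R.

Definition vanishing f := exists N, forall n, (N <= n)%N -> f n = 0%N.

Definition growth (S : R -> Prop) f :=
  vanishing f \/ exists l d, [/\ S l, 1 <= l & theta f l d].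

Lemma weight_gt0 d l n : 0 < l -> 0 < weight d l n.
Proof. by move=> l0; rewrite mulr_gt0 ?exprn_gt0 ?ltr0n. Qed.

Lemma ler_natX (a b d : nat) : (a <= b)%N -> a%:R ^+ d <= b%:R ^+ d :> R.
Proof. by move=> ab; rewrite lerXn2r ?nnegrE ?ler_nat. Qed.

Lemma dominated_ge0 f l d C :
  (forall n, (f n)%:R <= C * weight d l n) -> 0 <= C.
Proof.
by move=> /(_ 0%N); rewrite /weight expr1n expr0 !mulr1; apply: le_trans.
Qed.

Lemma polynomial_le_exponential d q :
  1 < q -> exists C : R, forall n, n.+1%:R ^+ d <= C * q ^+ n.
Proof.
elim: d q => [|d IHd] q q1.
  by exists 1 => n; rewrite expr0 mul1r exprn_ege1 // ltW.
pose s := (1 + q) / 2.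
have s1 : 1 < s by rewrite /s; lra.
have s0 : 0 < s by lra.
have sq : s < q by rewrite /s; lra.
have [C CP] : exists C : R, forall n, n.+1%:R ^+ d <= C * (q / s) ^+ n.
  by apply: IHd; rewrite ltr_pdivlMr ?mul1r.
have C0 : 0 <= C.
  by have := CP 0%N; rewrite expr1n expr0 mulr1; apply: le_trans.
have lin n : n.+1%:R <= (1 + (s - 1)^-1) * s ^+ n.
  have bern : 1 + (s - 1) *+ n <= s ^+ n.
    elim: n => [|n IH]; first by rewrite mulr0n expr0 addr0.
    rewrite exprS; apply: le_trans (ler_wpM2l (ltW s0) IH).
    have n0 : 0 <= (s - 1) * ((s - 1) *+ n) by rewrite mulr_ge0 ?mulrn_wge0 ?ltW// ; lra.
    by rewrite mulrSr; lra.
  have b2 : n%:R <= (s - 1)^-1 * s ^+ n.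
    rewrite ler_pdivlMl ?subr_gt0 //.
    by apply: le_trans bern; rewrite mulr_natr; lra.
  have b1 : 1 <= s ^+ n by rewrite exprn_ege1 // ltW.
  by rewrite mulrDl mul1r -natr1 addrC lerD.
exists (C * (1 + (s - 1)^-1)) => n.
have -> : C * (1 + (s - 1)^-1) * q ^+ n =
  (C * (q / s) ^+ n) * ((1 + (s - 1)^-1) * s ^+ n).
  rewrite mulrACA -exprMn divfK //; lra.
by rewrite exprSr ler_pM ?exprn_ge0 ?ler0n.
Qed.


Lemma dominated_mono f l q d e :
  0 < l -> (l < q \/ l = q /\ (d <= e)%N) -> dominated f l d -> dominated f q e.
Proof.
move=> l0 lq [C fC]; have C0 := dominated_ge0 fC.
suff [K KP] : exists K, forall n, weight d l n <= K * weight e q n.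
  by exists (C * K) => n; rewrite -mulrA (le_trans (fC n)) ?ler_wpM2l.
case: lq => [lq|[<- de]]; last first.
  exists 1 => n; rewrite mul1r /weight ler_wpM2r ?exprn_ge0 ?(ltW l0) //.
  by rewrite ler_weXn2l // ler1n.
have [K KP] : exists K : R, forall n, n.+1%:R ^+ d <= K * (q / l) ^+ n.
  by apply: polynomial_le_exponential; rewrite ltr_pdivlMr ?mul1r.
have q0 : 0 < q by exact: lt_trans lq.
exists K => n; apply: (@le_trans _ _ (K * q ^+ n)).
  rewrite -ler_pdivlMr ?exprn_gt0 // -mulrA -expr_div_n //.
have K0 : 0 <= K by have := KP 0%N; rewrite expr1n expr0 mulr1; apply: le_trans.
rewrite ler_wpM2l // ler_peMl ?exprn_ge0 ?(ltW q0) //.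
by rewrite exprn_ege1 // ler1n.
Qed.

Lemma vanishing_dominated f l d : 0 < l -> vanishing f -> dominated f l d.
Proof.
move=> l0 [N fN]; exists (\sum_(k < N) (f k)%:R / weight d l k) => n.
have [Nn|nN] := leqP N n.
  rewrite fN // mulr_ge0 ?(ltW (weight_gt0 _ _ l0)) // sumr_ge0 // => k _.
  by rewrite divr_ge0 // ltW // weight_gt0.
rewrite -ler_pdivrMr ?weight_gt0 // (bigD1 (Ordinal nN)) //= lerDl sumr_ge0 // => k _.
by rewrite divr_ge0 // ltW // weight_gt0.
Qed.

Lemma dominatedD f g l d :
  dominated f l d -> dominated g l d ->
  dominated (fun n => (f n + g n)%N) l d.
Proof.
move=> [C fC] [D gD]; exists (C + D) => n.
by rewrite natrD mulrDl lerD.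
Qed.

Lemma thetaD f g l d :
  theta f l d -> dominated g l d -> theta (fun n => (f n + g n)%N) l d.
Proof.
move=> [fC [c c0 [N fc]]] gD; split; first exact: dominatedD.
by exists c => //; exists N => n /fc; rewrite natrD; apply: ler_wpDr.
Qed.

Lemma eq_growth S f g : f =1 g -> growth S f -> growth S g.
Proof. by move=> /funext ->. Qed.

Lemma growthD S f g :
  growth S f -> growth S g -> growth S (fun n => (f n + g n)%N).
Proof.
wlog: f g / (exists l d, [/\ S l, 1 <= l & theta f l d]) => [H|+ _].
  move=> [[N fN]|fT] [[N' gN]|gT].
  - left; exists (maxn N N') => n; rewrite geq_max => /andP[/fN -> /gN ->] //.
  - by apply: (@eq_growth _ (fun n => (g n + f n)%N)) => [n|];
      [rewrite addnC|apply: H => //; [right|left; exists N]].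
  - by apply: H => //; [right|left; exists N'].
  - by apply: H => //; right.
move=> [l [d [Sl l1 fT]]] [gV|[q [e [Sq q1 gT]]]]; right.
  exists l, d; split=> //; apply: thetaD fT _.
  by apply: vanishing_dominated gV; lra.
have gf : (fun n => (g n + f n)%N) = (fun n => (f n + g n)%N).
  by apply/funext => n; rewrite addnC.
have [lq|ql|lq] := ltgtP l q.
- exists q, e; split=> //; rewrite -gf; apply: thetaD gT _.
  by apply: dominated_mono fT.1; [lra|left].
- exists l, d; split=> //; apply: thetaD fT _.
  by apply: dominated_mono gT.1; [lra|left].
- subst q; case: (leqP d e) => [de|/ltnW ed].
    exists l, e; split=> //; rewrite -gf; apply: thetaD gT _.
    by apply: dominated_mono fT.1; [lra|right].
  exists l, d; split=> //; apply: thetaD fT _.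
  by apply: dominated_mono gT.1; [lra|right].
Qed.

Lemma growth0 S : growth S (fun=> 0%N).
Proof. by left; exists 0%N. Qed.

Lemma growthM S f a : growth S f -> growth S (fun n => (f n * a)%N).
Proof.
move=> fG; elim: a => [|a IHa].
  by apply: eq_growth (growth0 S) => n; rewrite muln0.
by apply: eq_growth (growthD fG IHa) => n; rewrite mulnS.
Qed.

Lemma growth_sum S (I : Type) (s : seq I) (P : pred I) (F : I -> nat -> nat) :
  (forall k, P k -> growth S (F k)) ->
  growth S (fun n => \sum_(k <- s | P k) F k n)%N.
Proof.
move=> FG; elim: s => [|k s IHs].
  by apply: eq_growth (growth0 S) => n; rewrite big_nil.
have [Pk|Pk] := boolP (P k).
  by apply: eq_growth (growthD (FG k Pk) IHs) => n; rewrite big_cons Pk.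
by apply: eq_growth IHs => n; rewrite big_cons (negbTE Pk).
Qed.

Definition conv f g n := (\sum_(t < n) f t * g (n.-1 - t))%N.

Lemma convC f g : conv f g =1 conv g f.
Proof.
move=> n; rewrite /conv (reindex_inj rev_ord_inj) /=.
apply: eq_bigr => t _; rewrite mulnC; congr (g _ * f _)%N; have := ltn_ord t; lia.
Qed.

Lemma conv_theta_lt f g l q d e s :
  0 < q < l -> 1 <= l -> (0 < g s)%N ->
  theta f l d -> dominated g q e -> theta (conv f g) l d.
Proof.
move=> /andP[q0 ql] l1 gs [[C fC] [c c0 [N fc]]] gD.
have l0 : 0 < l by lra.
have C0 := dominated_ge0 fC.
split.
  pose v := (q + l) / 2.
  have qv : q < v by rewrite /v; lra.
  have vl : v < l by rewrite /v; lra.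
  have v0 : 0 < v by lra.
  have [D gC] : dominated g v 0 by apply: dominated_mono gD; [|left].
  have D0 := dominated_ge0 gC.
  exists (C * D / (l - v)) => n.
  have geo : (l - v) * (\sum_(t < n) l ^+ t * v ^+ (n.-1 - t)) <= l ^+ n.
    have := subrXX v l n; rewrite -(opprB l v) mulNr => /eqP.
    rewrite -eqr_oppLR opprB => /eqP; under eq_bigr do rewrite mulrC.
    by move=> <-; rewrite gerBl exprn_ge0 // ltW.
  have step : (conv f g n)%:R <=
      C * D * n.+1%:R ^+ d * \sum_(t < n) l ^+ t * v ^+ (n.-1 - t).
    rewrite natr_sum mulr_sumr; apply: ler_sum => t _.
    have := fC t; have := gC (n.-1 - t)%N; rewrite /weight expr0 mul1r => gt ft.
    rewrite natrM; apply: le_trans (ler_pM _ _ ft gt) _ => //.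
    rewrite [leLHS](_ : _ = C * D * (t.+1%:R ^+ d * (l ^+ t * v ^+ (n.-1 - t))));
      last by ring.
    rewrite mulrA ler_wpM2r ?mulr_ge0 ?exprn_ge0 ?(ltW l0) ?(ltW v0) //.
    rewrite ler_wpM2l ?mulr_ge0 //.
    by rewrite ler_natX // (leq_trans (ltn_ord t)).
  apply: le_trans step _; rewrite /weight -!mulrA; do 2 (rewrite ler_wpM2l //).
  rewrite mulrCA ler_wpM2l ?exprn_ge0 //.
  by rewrite ler_pdivlMl // subr_gt0.
exists (c / s.+2%:R ^+ d / l ^+ s.+1); first by rewrite !divr_gt0 ?exprn_gt0 ?ltr0n.
exists (N + s).+1 => n Nn.
have sn : (n - s.+1 < n)%N by lia.
have le1 : (f (n - s.+1) * g s <= conv f g n)%N.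
  rewrite /conv (bigD1 (Ordinal sn)) //=.
  have -> : (n.-1 - (n - s.+1) = s)%N by lia.
  exact: leq_addr.
have le2 : (f (n - s.+1) <= conv f g n)%N by apply: leq_trans le1; rewrite leq_pmulr.
have Nn' : (N <= n - s.+1)%N by lia.
apply: (@le_trans _ _ (f (n - s.+1)%N)%:R); last by rewrite ler_nat.
apply: le_trans (fc _ Nn'); rewrite /weight -!mulrA ler_wpM2l ?(ltW c0) //.
have -> : l ^+ n = l ^+ (n - s.+1) * l ^+ s.+1 by rewrite -exprD subnK //; lia.
rewrite [leLHS](_ : _ = n.+1%:R ^+ d / s.+2%:R ^+ d * l ^+ (n - s.+1)); last first.
  by field; rewrite !expf_neq0 ?pnatr_eq0 ?gt_eqF.
rewrite ler_wpM2r ?exprn_ge0 ?(ltW l0) // ler_pdivrMr ?exprn_gt0 ?ltr0n //.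
rewrite -exprMn -natrM ler_natX //; nia.
Qed.

Lemma conv_theta_eq f g l d e :
  1 <= l -> theta f l d -> theta g l e -> theta (conv f g) l (d + e).+1.
Proof.
move=> l1 [[C fC] [c c0 [N fc]]] [[D gD] [a a0 [N' ga]]].
have l0 : 0 < l by lra.
have C0 := dominated_ge0 fC; have D0 := dominated_ge0 gD.
split.
  exists (C * D) => n.
  have -> : C * D * weight (d + e).+1 l n = C * D * weight (d + e) l n *+ n.+1.
    by rewrite /weight exprSr -mulr_natr; ring.
  apply: (@le_trans _ _ (C * D * weight (d + e) l n *+ n)); last first.
    rewrite -[leLHS]mulr_natr -[leRHS]mulr_natr ler_wpM2l ?ler_nat //.
    by rewrite mulr_ge0 ?(ltW (weight_gt0 _ _ l0)) ?mulr_ge0.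
  rewrite natr_sum -[X in _ *+ X]card_ord -sumr_const; apply: ler_sum => t _.
  rewrite natrM; apply: le_trans (ler_pM _ _ (fC _) (gD _)) _ => //.
  rewrite mulrACA ler_wpM2l ?mulr_ge0 // /weight mulrACA -exprD.
  have tn := ltn_ord t.
  apply: ler_pM; rewrite ?mulr_ge0 ?exprn_ge0 ?(ltW l0) //; last first.
    by rewrite ler_weXn2l //; lia.
  by rewrite exprD ler_pM ?exprn_ge0 // ler_natX; lia.
exists (c * a / 6%:R ^+ (d + e).+1 / l).
  by rewrite !divr_gt0 ?mulr_gt0 // exprn_gt0.
exists (3 * (N + N').+1)%N => n Nn.
have [k [k1 kN kN' kn nk]] :
    exists k, [/\ (0 < k)%N, (N <= k)%N, (N' <= k)%N, (3 * k <= n)%N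
             & (n.+1 <= 6 * k)%N].
  have [k nk3 k3n] : exists2 k, (3 * k <= n)%N & (n < 3 * k + 3)%N.
    by exists (n %/ 3)%N; lia.
  by exists k; split; lia.
have cut : (\sum_(k <= t < k + k) f t * g (n.-1 - t) <= conv f g n)%N.
  rewrite /conv -(big_mkord xpredT (fun t => f t * g (n.-1 - t))%N).
  have [k2 k2n] : (k <= k + k)%N /\ (k + k <= n)%N by lia.
  rewrite (big_cat_nat (leq0n k) (leq_trans k2 k2n)) /=.
  by rewrite (big_cat_nat k2 k2n) /= addnCA leq_addr.
apply: (@le_trans _ _ (\sum_(k <= t < k + k) f t * g (n.-1 - t))%N%:R); last first.
  by rewrite ler_nat.
rewrite natr_sum.
apply: (@le_trans _ _ (\sum_(k <= t < k + k) c * a * (k%:R ^+ (d + e) * l ^+ n.-1))).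
  rewrite sumr_const_nat addnK /weight.
  have -> : l ^+ n = l * l ^+ n.-1 by rewrite -exprS; congr (_ ^+ _); lia.
  have X0 : 0 <= c * a * l ^+ n.-1.
    by rewrite !mulr_ge0 ?exprn_ge0 ?(ltW c0) ?(ltW a0) ?(ltW l0).
  rewrite -[leRHS]mulr_natr [leLHS](_ : _ =
    c * a * l ^+ n.-1 * (n.+1%:R ^+ (d + e).+1 / 6%:R ^+ (d + e).+1)); last first.
    have : l != 0 by rewrite gt_eqF.
    have : 6%:R ^+ (d + e).+1 != 0 :> R by rewrite expf_neq0 ?pnatr_eq0.
    move: (6%:R ^+ _) (n.+1%:R ^+ _) (l ^+ _) => z w1 w2 z0 l_neq0.
    by field; rewrite z0 l_neq0.
  rewrite [leRHS](_ : _ = c * a * l ^+ n.-1 * k%:R ^+ (d + e).+1); last first.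
    by rewrite exprSr; ring.
  rewrite ler_wpM2l // ler_pdivrMr ?exprn_gt0 ?ltr0n // -exprMn -natrM mulnC.
  exact: ler_natX.
apply: ler_sum_nat => t /andP[kt tk].
have ft : (N <= t)%N by lia.
have gt : (N' <= n.-1 - t)%N by lia.
have wf : 0 <= c * weight d l t by rewrite mulr_ge0 ?(ltW (weight_gt0 _ _ l0)) // ltW.
have wg : 0 <= a * weight e l (n.-1 - t).
  by rewrite mulr_ge0 ?(ltW (weight_gt0 _ _ l0)) // ltW.
rewrite natrM; apply: le_trans (ler_pM wf wg (fc _ ft) (ga _ gt)).
rewrite [leRHS]mulrACA ler_wpM2l ?mulr_ge0 ?(ltW c0) ?(ltW a0) // /weight mulrACA -exprD.
have -> : (t + (n.-1 - t) = n.-1)%N by lia.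
rewrite ler_wpM2r ?exprn_ge0 ?(ltW l0) // exprD.
by rewrite ler_pM ?exprn_ge0 // ler_natX; lia.
Qed.

Lemma growth_conv S f g : growth S f -> growth S g -> growth S (conv f g).
Proof.
have cC u v : growth S (conv u v) -> growth S (conv v u).
  by apply: eq_growth => n; rewrite convC.
have conv0 u v : v =1 (fun=> 0%N) -> growth S (conv u v).
  move=> v0; apply: eq_growth (growth0 S) => n.
  by rewrite /conv big1 // => t _; rewrite v0 muln0.
have main u v l q d e : 0 < q < l -> 1 <= l -> S l -> theta u l d ->
    dominated v q e -> growth S (conv u v).
  move=> ql l1 Sl uT vD; have [[s vs]|v0] := pselect (exists s, 0 < v s)%N.
    right; exists l, d; split=> //; exact: (conv_theta_lt ql l1 vs uT vD).
  apply: conv0 => s; apply/eqP; rewrite -leqn0 leqNgt; apply/negP => vs.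
  by apply: v0; exists s.
have half l : 1 <= l -> 0 < (1 / 2 : R) < l by move=> ?; apply/andP; split; lra.
move=> [[N fN]|[l [d [Sl l1 fT]]]] [[N' gN]|[q [e [Sq q1 gT]]]].
- left; exists (N + N').+1 => n Nn; rewrite /conv big1 // => t _.
  have [Nt|tN] := leqP N t; first by rewrite fN.
  by rewrite gN ?muln0 //; lia.
- apply/cC/(main _ _ _ _ _ 0%N (half _ q1) q1 Sq gT).
  by apply: vanishing_dominated; [lra|exists N].
- apply/(main _ _ _ _ _ 0%N (half _ l1) l1 Sl fT).
  by apply: vanishing_dominated; [lra|exists N'].
have [lq|ql|lq] := ltgtP l q.
- by apply/cC/(main _ _ _ l _ d _ q1 Sq gT fT.1); rewrite lq andbT; lra.
- by apply/(main _ _ _ q _ e _ l1 Sl fT gT.1); rewrite ql andbT; lra.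
- subst q; right; exists l, (d + e).+1; split=> //; exact: conv_theta_eq.
Qed.

End Growth.

Lemma expmxS (R : pzSemiRingType) n (A : 'M[R]_n) k : A ^+ k.+1 = A *m A ^+ k.
Proof. exact: exprS. Qed.

Lemma expmxSr (R : pzSemiRingType) n (A : 'M[R]_n) k : A ^+ k.+1 = A ^+ k *m A.
Proof. exact: exprSr. Qed.

Lemma expmxD (R : pzSemiRingType) n (A : 'M[R]_n) k h :
  A ^+ (k + h) = A ^+ k *m A ^+ h.
Proof. exact: exprD. Qed.

Section Perron.
Variable R : realType.

Definition subinvariant n (B : 'M[R]_n) : set (R * 'rV[R]_n) :=
  [set p : R * 'rV[R]_n | [/\ 0 <= p.1, forall j, 0 <= p.2 0 j, \sum_j p.2 0 j = 1
             & forall j, p.1 * p.2 0 j <= (p.2 *m B) 0 j]].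

Lemma subinvariant_le n (B : 'M[R]_n) (p : R * 'rV[R]_n) : subinvariant B p ->
  (forall i j, 0 <= B i j) ->
  p.1 <= \sum_j \sum_i B i j /\ forall j, p.2 0 j <= 1.
Proof.
case: p => l x [/= l0 x0 x1 lx] B0.
have xj1 j : x 0 j <= 1.
  by rewrite -x1 (bigD1 j) //= lerDl sumr_ge0.
split=> //; rewrite -[leLHS]mulr1 -x1 mulr_sumr; apply: ler_sum => j _.
by apply: le_trans (lx j) _; rewrite mxE; apply: ler_sum => i _; rewrite ler_piMl.
Qed.

Lemma coord2_continuous n j : continuous (fun p : R * 'rV[R]_n => p.2 0 j).
Proof.
move=> p; apply: (@continuous_comp _ _ _ snd (fun x : 'rV[R]_n => x 0 j)).
  exact: cvg_snd.
exact: coord_continuous.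
Qed.

Lemma sum_continuous (T : topologicalType) (I : Type) (s : seq I)
    (F : I -> T -> R) :
  (forall i, continuous (F i)) -> continuous (fun x => \sum_(i <- s) F i x).
Proof.
move=> Fc x; elim: s => [|i s IHs].
  by under eq_fun do rewrite big_nil; exact: cst_continuous.
by under eq_fun do rewrite big_cons; apply: continuousD IHs; exact: Fc.
Qed.

Lemma compact_subinvariant n (B : 'M[R]_n) :
  (forall i j, 0 <= B i j) -> compact (subinvariant B).
Proof.
move=> B0; pose b := \sum_j \sum_i B i j.
pose K : set (R * 'rV[R]_n) := `[0, b]%classic `*`
  [set x : 'rV[R]_n | forall i, `[0, 1]%classic (x ord0 i)].
have Kc : compact K.
  apply: compact_setX; first exact: segment_compact.
  have := @rV_compact R n (fun=> `[0, 1]%classic) (fun=> @segment_compact R 0 1).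
  exact.
pose D1 : set (R * 'rV[R]_n) :=
  (fun p : R * 'rV[R]_n => \sum_j p.2 0 j) @^-1` [set y | y = 1].
pose D2 : set (R * 'rV[R]_n) := \bigcap_(j in setT)
  (fun p : R * 'rV[R]_n => \sum_i p.2 0 i * B i j - p.1 * p.2 0 j) @^-1` [set y | 0 <= y].
have D1c : closed D1.
  apply: closed_comp => [p _|]; last exact: closed_eq.
  by apply: sum_continuous => j; exact: coord2_continuous.
have D2c : closed D2.
  apply: closed_bigI => j _; apply: closed_comp => [p _|]; last exact: closed_ge.
  apply: cvgB.
    apply: sum_continuous => i q; apply: cvgM; first exact: coord2_continuous.
    exact: cst_continuous.
  apply: cvgM; [exact: cvg_fst|exact: coord2_continuous].
suff -> : subinvariant B = K `&` D1 `&` D2.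
  by do 2 (apply: compact_closedI => //).
apply/seteqP; split=> [p pS|p [[[/= p1 p2] p3] p4]].
  have [pb px] := subinvariant_le pS B0; case: pS => p0 px0 ps pB.
  split; last by move=> j _ /=; rewrite subr_ge0; have := pB j; rewrite mxE.
  split; last by [].
  by split=> [|j] /=; rewrite in_itv /= ?p0 ?px0 ?px.
split=> //.
- by move: p1; rewrite in_itv => /andP[].
- by move=> j; have := p2 j; rewrite /= in_itv => /andP[].
- by move=> j; have := p4 j I; rewrite /= subr_ge0 mxE.
Qed.

Lemma subinvariant_max n (B : 'M[R]_n) : (0 < n)%N ->
  (forall i j, 0 <= B i j) ->
  exists (l : R) (x : 'rV[R]_n), subinvariant B (l, x) /\
    forall (q : R) (y : 'rV[R]_n), subinvariant B (q, y) -> q <= l.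
Proof.
move=> n0 B0; pose i0 := Ordinal n0.
have B0x : subinvariant B (0, delta_mx 0 i0).
  split=> //= [j||j].
  - by rewrite mxE eqxx ler0n.
  - rewrite (bigD1 i0) //= mxE !eqxx big1 ?addr0 // => j /negbTE ji.
    by rewrite mxE ji andbF.
  - by rewrite mul0r -rowE mxE.
have [||[l x] /set_mem lx lmax] :=
    @compact_EVT_max _ R fst _ _ (compact_subinvariant B0).
- by exists (0, delta_mx 0 i0).
- by apply: continuous_subspaceT => p; exact: cvg_fst.
by exists l, x; split=> // q y qy; exact: lmax (mem_set qy).
Qed.

(* A maximal [l] with [l x <= x B] for some [x] in the simplex is attained with
   equality: otherwise [x B^k] would be strictly subinvariant, and [l] could be
   increased. *)
Lemma perron n (B : 'M[R]_n) k : (0 < n)%N ->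
  (forall i j, 0 <= B i j) -> (forall i j, 0 < (B ^+ k) i j) ->
  exists (l : R) (x : 'rV[R]_n),
    [/\ 0 <= l, forall j, 0 < x 0 j & x *m B = l *: x].
Proof.
move=> n0 B0 Bk; pose i0 := Ordinal n0.
have [l [x [[/= l0 x0 x1 lx] lmax]]] := subinvariant_max n0 B0.
have pos (y : 'rV[R]_n) : (forall j, 0 <= y 0 j) -> y != 0 ->
    forall j, 0 < (y *m B ^+ k) 0 j.
  move=> y0 y_neq0 j; have /existsP[i yi] : [exists i, y 0 i != 0].
    rewrite -negb_forall; apply: contra y_neq0 => /forallP yz.
    by apply/eqP/rowP => i; rewrite mxE; apply/eqP.
  rewrite mxE (bigD1 i) //= ltr_pwDl ?sumr_ge0 // => [|h _]; last first.
    by rewrite mulr_ge0 // ltW.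
  by rewrite mulr_gt0 // lt_neqAle eq_sym y0 andbT.
have x_neq0 : x != 0.
  apply: contra_eq_neq x1 => ->; rewrite big1 => [|j _]; last by rewrite mxE.
  by rewrite eq_sym oner_neq0.
have xB : x *m B = l *: x.
  apply/eqP; rewrite -subr_eq0; apply: contraT => z_neq0.
  pose y := x *m B ^+ k; pose w := (x *m B - l *: x) *m B ^+ k.
  have y0 : forall j, 0 < y 0 j by exact: pos.
  have w0 : forall j, 0 < w 0 j.
    by apply: pos => // j; rewrite !mxE subr_ge0; have := lx j; rewrite mxE.
  have yB : y *m B = l *: y + w.
    rewrite /w mulmxBl -scalemxAl subrKC /y -!mulmxA.
    by rewrite -expmxS expmxSr.
  clearbody y w.
  pose e := (\sum_j y 0 j / w 0 j)^-1.
  have e0 : 0 < e.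
    rewrite invr_gt0 (bigD1 i0) //= ltr_pwDl ?divr_gt0 // sumr_ge0 // => j _.
    by rewrite ltW ?divr_gt0.
  have ey j : e * y 0 j <= w 0 j.
    have Z0 : 0 < \sum_j y 0 j / w 0 j by rewrite -invr_gt0.
    rewrite /e ler_pdivrMl // -ler_pdivrMr // (bigD1 j) //= lerDl.
    by rewrite sumr_ge0 // => h _; rewrite ltW ?divr_gt0.
  pose s := \sum_j y 0 j.
  have s0 : 0 < s by rewrite /s (bigD1 i0) //= ltr_pwDl // sumr_ge0 // => j _; exact: ltW.
  suff : l + e <= l by lra.
  apply: (lmax (l + e) (s^-1 *: y)); split=> /=.
  - by rewrite addr_ge0 // ltW.
  - by move=> j; rewrite mxE mulr_ge0 ?invr_ge0 ?ltW.
  - by under eq_bigr do rewrite mxE; rewrite -mulr_sumr mulVf ?gt_eqF.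
  - move=> j; rewrite -scalemxAl [in leRHS]mxE [(s^-1 *: y) 0 j]mxE mulrCA.
    rewrite ler_wpM2l ?invr_ge0 ?(ltW s0) // yB !mxE.
    by rewrite mulrDl lerD2l.
exists l, x; split=> // j.
have : 0 < (x *m B ^+ k) 0 j by exact: pos.
have -> : x *m B ^+ k = l ^+ k *: x.
  elim: k {Bk pos} => [|h IH]; first by rewrite !expr0 mulmx1 scale1r.
  by rewrite expmxSr mulmxA IH -scalemxAl xB scalerA -exprSr.
rewrite mxE => xj; rewrite lt_neqAle x0 andbT.
by apply: contraTneq xj => <-; rewrite mulr0 ltxx.
Qed.

End Perron.

Section PeriodClasses.
Variables (m : nat).
Implicit Types (P A B : 'M[nat]_m).

Lemma matrix_mul_gt0 (n p q : nat) (A : 'M[nat]_(n, p)) (B : 'M[nat]_(p, q)) i j :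
  (0 < (A *m B) i j)%N = [exists l, (0 < A i l)%N && (0 < B l j)%N].
Proof.
rewrite mxE lt0n -[X in X != _]/(\sum_l A i l * B l j)%N.
rewrite sum_nat_eq0 negb_forall; apply: eq_existsb => l /=.
by rewrite -lt0n muln_gt0.
Qed.

Definition step P : rel 'I_m := fun i j => (0 < P i j)%N.

Lemma expmx_gt0_connect P n i j : (0 < (P ^+ n) i j)%N -> connect (step P) i j.
Proof.
elim: n i j => [|n IHn] i j.
  by rewrite expr0 mxE; case: eqP => // ->; rewrite connect0.
rewrite expmxS matrix_mul_gt0 => /existsP[l /andP[il /IHn]].
by apply: connect_trans; exact: connect1.
Qed.

Definition classmates P i : {set 'I_m} :=
  [set j | connect (step P) i j && connect (step P) j i].

Lemma primitive_block_form_classes P (s : 'S_m) :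
  primitive_block_form (perm_mx s^-1 *m P *m perm_mx s) -> forall i,
  (classmates P i = [set i]%SET /\ forall n, (0 < n)%N -> (P ^+ n) i i = 0%N) \/
  (exists2 K, (0 < K)%N &
    forall k l, k \in classmates P i -> l \in classmates P i ->
    (0 < (P ^+ K) k l)%N).
Proof.
move=> [c [d [e [d0 tri blk]]]].
rewrite -row_permE -[s in perm_mx s]invgK -col_permE in tri blk.
set Z := castmx _ _ in tri blk.
pose h j : 'I_(\sum_a d a) := cast_ord e (s j).
pose g x : 'I_m := (s^-1)%g (cast_ord (esym e) x).
have hK : cancel h g by move=> j; rewrite /g /h cast_ordK permK.
have gK : cancel g h by move=> j; rewrite /g /h permKV cast_ordKV.
pose cls j := tagnat.sig1 (h j).
pose B a b := \matrix_(u, v) P (g (@tagnat.Rank _ d a u)) (g (@tagnat.Rank _ d b v)).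
have BE a b : submxblock Z a b = B a b.
  by apply/matrixP => u v; rewrite !mxE /Z castmxE /= !mxE.
have clsP j a : cls j = a -> exists u, j = g (@tagnat.Rank _ d a u).
  by move=> <-; exists (tagnat.sig2 (h j)); rewrite tagnat.sig2K hK.
have gC a u : cls (g (@tagnat.Rank _ d a u)) = a by rewrite /cls gK tagnat.Rank1K.
have Bcls i j : P i j = B (cls i) (cls j) (tagnat.sig2 (h i)) (tagnat.sig2 (h j)).
  by rewrite mxE !tagnat.sig2K !hK.
have cls_eq i j : connect (step P) i j -> connect (step P) j i -> cls i = cls j.
  have mono (r : rel 'I_c) : reflexive r -> transitive r ->
      (forall i j, step P i j -> r (cls i) (cls j)) ->
      forall i j, connect (step P) i j -> r (cls i) (cls j).
    move=> rr rt rs i' j' /connectP[w wP ->]; elim: w i' wP => [|y w IHw] x /=.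
      by rewrite rr.
    by case/andP=> /rs xy /IHw; exact: rt.
  have B_neq0 a b u v : (0 < B a b u v)%N -> submxblock Z a b <> 0.
    by move=> Buv; rewrite BE => B0; move: Buv; rewrite B0 mxE.
  move=> ij ji; apply/val_inj/eqP; rewrite eqn_leq.
  case: tri => tri.
    have up := mono (fun a b => a <= b)%N leqnn (fun _ _ _ => @leq_trans _ _ _).
    by rewrite !up // => x y; rewrite /step Bcls => /B_neq0 Bxy;
      rewrite leqNgt; apply/negP => /tri.
  have up := mono (fun a b => b <= a)%N leqnn (fun _ _ _ yx zy => leq_trans zy yx).
  by rewrite !up // => x y; rewrite /step Bcls => /B_neq0 Bxy;
    rewrite leqNgt; apply/negP => /tri.
have Bpow a n u v : (0 < (B a a ^+ n) u v)%N ->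
    (0 < (P ^+ n) (g (@tagnat.Rank _ d a u)) (g (@tagnat.Rank _ d a v)))%N.
  elim: n u v => [|n IHn] u v.
    by rewrite !expr0 !mxE; case: (u =P v) => // ->; rewrite eqxx.
  rewrite !expmxS !matrix_mul_gt0 => /existsP[w /andP[uw /IHn wv]].
  apply/existsP; exists (g (@tagnat.Rank _ d a w)).
  by rewrite wv andbT; move: uw; rewrite mxE.
move=> i; case: (blk (cls i)); rewrite BE.
  case=> K K0 BK; right; exists K => // k l.
  rewrite !inE => /andP[ik ki] /andP[il li].
  have [u ->] := clsP k (cls i) (esym (cls_eq _ _ ik ki)).
  have [v ->] := clsP l (cls i) (esym (cls_eq _ _ il li)).
  exact: Bpow.
case=> di B0; left.
have cls1 l : connect (step P) i l -> connect (step P) l i -> l = i.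
  move=> il li; have [u ->] := clsP i _ erefl.
  have [v ->] := clsP l _ (esym (cls_eq _ _ il li)).
  congr (g (tagnat.Rank _ _)); apply/ord_inj.
  by have := ltn_ord u; have := ltn_ord v; lia.
split.
  apply/setP => l; rewrite !inE; apply/andP/eqP => [[]|->]; first exact: cls1.
  by rewrite connect0.
case=> // n _; apply/eqP; rewrite -leqn0 leqNgt; apply/negP.
rewrite expmxS matrix_mul_gt0 => /existsP[l /andP[il /expmx_gt0_connect li]].
by move: (il); rewrite (cls1 l (connect1 il) li) /step Bcls B0 mxE.
Qed.

End PeriodClasses.

Section PrimitiveGrowth.
Variable R : realType.

Definition natmx (F : pzSemiRingType) m n (A : 'M[nat]_(m, n)) : 'M[F]_(m, n) :=
  map_mx (fun k => k%:R) A.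

Lemma natmxM (F : pzSemiRingType) m n p (A : 'M[nat]_(m, n)) (B : 'M[nat]_(n, p)) :
  natmx F (A *m B) = natmx F A *m natmx F B.
Proof.
apply/matrixP => i j; rewrite !mxE natr_sum; apply: eq_bigr => k _.
by rewrite !mxE natrM.
Qed.

Lemma natmxX (F : pzSemiRingType) n (A : 'M[nat]_n) k :
  natmx F (A ^+ k) = natmx F A ^+ k.
Proof.
elim: k => [|k IHk].
  by apply/matrixP => i j; rewrite !expr0 !mxE; case: eqP.
by rewrite !expmxS natmxM IHk.
Qed.

Lemma primitive_theta n (B : 'M[nat]_n) K : (0 < n)%N -> (0 < K)%N ->
  (forall i j, (0 < (B ^+ K) i j)%N) ->
  exists (l : R) (x : 'rV[R]_n),
    [/\ 1 <= l, forall j, 0 < x 0 j, x *m natmx R B = l *: x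
      & forall i j, theta (fun k => (B ^+ k) i j) l 0].
Proof.
move=> n0 K0 BK.
have [||l [x [l0 x0 xB]]] := @perron R n (natmx R B) K n0.
- by move=> i j; rewrite mxE.
- by move=> i j; rewrite -natmxX mxE ltr0n.
have xBk k : x *m natmx R (B ^+ k) = l ^+ k *: x.
  rewrite natmxX; elim: k => [|k IH]; first by rewrite !expr0 mulmx1 scale1r.
  by rewrite expmxSr mulmxA IH -scalemxAl xB scalerA -exprSr.
have xBkE k j : \sum_h x 0 h * ((B ^+ k) h j)%:R = l ^+ k * x 0 j.
  by have /rowP/(_ j) := xBk k; rewrite !mxE => <-; apply: eq_bigr => h _; rewrite mxE.
pose s := \sum_h x 0 h.
have xs h : x 0 h <= s.
  by rewrite /s (bigD1 h) //= lerDl sumr_ge0 // => q _; exact: ltW.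
have l1 : 1 <= l.
  pose j := Ordinal n0.
  have : 1 <= l ^+ K.
    rewrite -(ler_pM2r (x0 j)) mul1r -xBkE; apply: le_trans (xs j) _.
    by apply: ler_sum => h _; rewrite ler_peMr ?(ltW (x0 _)) // ler1n.
  by apply: contraTT; rewrite -!ltNge => l_lt1; rewrite exprn_ilt1 // -lt0n.
have lgt0 : 0 < l by lra.
have s0 : 0 < s by exact: lt_le_trans (x0 (Ordinal n0)) (xs _).
exists l, x; split=> // i j; split.
  exists (x 0 j / x 0 i) => k; rewrite /weight expr0 mul1r.
  rewrite mulrAC ler_pdivlMr // mulrC [leRHS]mulrC -xBkE (bigD1 i) //= lerDl.
  by rewrite sumr_ge0 // => h _; rewrite mulr_ge0 ?(ltW (x0 _)).
exists (x 0 j / s / l ^+ K); first by rewrite !divr_gt0 ?exprn_gt0.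
exists K => k Kk; rewrite /weight expr0 mul1r.
have -> : l ^+ k = l ^+ K * l ^+ (k - K) by rewrite -exprD subnKC.
rewrite mulrA divfK ?expf_neq0 ?gt_eqF // mulrAC ler_pdivrMr // mulrC -xBkE.
rewrite -[in leRHS](subnKC Kk) expmxD mxE natr_sum mulr_suml; apply: ler_sum => h _.
rewrite mulrC natrM ler_pM ?(ltW (x0 _)) //.
by rewrite ler_peMl // ler1n.
Qed.

End PrimitiveGrowth.

Section Classes.
Variables (m : nat) (P : 'M[nat]_m).

Lemma classmates_refl i : i \in classmates P i.
Proof. by rewrite inE connect0. Qed.

Lemma classmates_convex i k l q : k \in classmates P i -> l \in classmates P i ->
  connect (step P) k q -> connect (step P) q l -> q \in classmates P i.
Proof.
rewrite !inE => /andP[ik _] /andP[_ li] kq ql.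
by rewrite (connect_trans ik kq) (connect_trans ql li).
Qed.

Lemma mxsub_classmates_exp i n (f := fun a : 'I_#|classmates P i| => enum_val a) :
  mxsub f f P ^+ n = mxsub f f (P ^+ n).
Proof.
elim: n => [|n IHn].
  by apply/matrixP => a b; rewrite !expr0 !mxE (inj_eq enum_val_inj).
apply/matrixP => a b; rewrite !expmxS IHn !mxE.
under eq_bigr do rewrite !mxE.
rewrite -(big_enum_val (fun q => P (f a) q * (P ^+ n) q (f b))).
rewrite [RHS](bigID (mem (classmates P i))) /= [X in _ = _ + X]big1 ?addr0 // => q.
apply: contraNeq; rewrite -[_ * _]/(_ * _)%N -lt0n muln_gt0 => /andP[aq qb].
apply: (@classmates_convex _ (f a) (f b)); rewrite ?enum_valP //.
  exact: connect1.
exact: expmx_gt0_connect qb.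
Qed.

(* If [P - l] were invertible, it would restrict to an automorphism of the
   [P]-stable space of rows supported on the indices [U] strictly below the
   class of [i].  It maps the extension by zero of [x] into that space, but this
   extension does not vanish at [i]. *)
Lemma eigenvalue_classmates (F : fieldType) i
    (f := fun a : 'I_#|classmates P i| => enum_val a) (x : 'rV[F]_#|classmates P i|) l :
  (forall a, x 0 a != 0) -> x *m natmx F (mxsub f f P) = l *: x ->
  eigenvalue (natmx F P) l.
Proof.
move=> x0 xl; rewrite /eigenvalue /eigenspace kermx_eq0.
set A := natmx F P - l%:M; apply/negP => Afree.
pose U := [set q | connect (step P) i q && ~~ connect (step P) q i]%SET.
pose D : 'M[F]_m := diag_mx (\row_q (q \in U)%:R).
have DE n (B : 'M[F]_(n, m)) k q : (B *m D) k q = B k q * (q \in U)%:R.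
  by rewrite mul_mx_diag !mxE.
have D_sub n (B : 'M[F]_(n, m)) : (forall k q, q \notin U -> B k q = 0) -> (B <= D)%MS.
  move=> B0; apply/submxP; exists B; apply/matrixP => k q; rewrite DE.
  by case: (boolP (q \in U)) => [_|/B0->]; rewrite ?mulr1 ?mulr0.
have DA : (D *m A <= D)%MS.
  apply: D_sub => k q qU; rewrite mul_diag_mx !mxE.
  have [kU|] := boolP (k \in U); last by rewrite mul0r.
  have kq : k != q by apply: contraNneq qU => <-.
  rewrite (negbTE kq) mulr0n subr0 mul1r.
  suff /eqP -> : P k q == 0%N by [].
  rewrite -leqn0 leqNgt; apply: contra qU => Pkq.
  move: kU; rewrite !inE => /andP[ik ki].
  rewrite (connect_trans ik (connect1 Pkq)) /=; apply: contra ki.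
  exact: connect_trans (connect1 Pkq).
have DDA : (D <= D *m A)%MS.
  by rewrite -(geq_leqif (mxrank_leqif_sup DA)) mxrankMfree.
pose y := x *m rowsub f 1%:M.
have yA : (y *m A <= D)%MS.
  apply: D_sub => k q; rewrite ord1 => qU {k}.
  have yE : y 0 q = \sum_a x 0 a * (f a == q)%:R.
    by rewrite mxE; apply: eq_bigr => a _; rewrite !mxE.
  have -> : (y *m A) 0 q = \sum_a x 0 a * (P (f a) q)%:R - l * y 0 q.
    have -> : y *m A = x *m rowsub f (natmx F P) - l *: y.
      by rewrite mulmxBr mul_mx_scalar /y -mulmxA -rowsubE.
    by move: (y) => v; rewrite !mxE; congr (_ - _); apply: eq_bigr => a _; rewrite !mxE.
  have [qC|qC] := boolP (q \in classmates P i).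
    have [b qb] : exists b, q = f b.
      by exists (enum_rank_in qC q); rewrite /f enum_rankK_in.
    have -> : y 0 q = x 0 b.
      rewrite yE (bigD1 b) //= qb eqxx mulr1 big1 ?addr0 // => a ab.
      by rewrite (inj_eq enum_val_inj) (negbTE ab) mulr0.
    have /rowP/(_ b) := xl; rewrite !mxE => <-; apply/eqP; rewrite subr_eq0; apply/eqP.
    by apply: eq_bigr => a _; rewrite !mxE qb.
  rewrite yE !big1 ?mulr0 ?subr0 // => a _.
    rewrite (_ : (f a == q) = false) ?mulr0 //.
    by apply: contraNF qC => /eqP <-; exact: enum_valP.
  suff /eqP -> : P (f a) q == 0%N by rewrite mulr0.
  rewrite -leqn0 leqNgt; apply: contra qC => Paq.
  have := enum_valP a; rewrite !inE => /andP[ia ai].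
  have iq := connect_trans ia (connect1 Paq); rewrite iq /=.
  by move: qU; rewrite inE iq negbK.
have : (y <= D)%MS by rewrite -(submxMfree _ _ Afree); exact: submx_trans DDA.
case/submxP => w /rowP/(_ i); rewrite DE inE connect0 andbF mulr0 mxE.
pose a := enum_rank_in (classmates_refl i) i.
have ai : f a = i by rewrite /f enum_rankK_in ?classmates_refl.
rewrite (bigD1 a) //= !mxE ai eqxx mulr1 big1 ?addr0 => [/eqP|b ba].
  by rewrite (negbTE (x0 a)).
rewrite !mxE (_ : (f b == i) = false) ?mulr0 //.
by rewrite -ai (inj_eq enum_val_inj) (negbTE ba).
Qed.

End Classes.

Section FirstExit.

Lemma first_exit (T : pzSemiRingType) (e e' p : T) :
  e + e' = 1 -> e * e' = 0 ->
  (forall t, e * p * (e * p ^+ t * e) = e * p ^+ t.+1 * e) ->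
  forall n, e * p ^+ n * e' =
    \sum_(t < n) e * p ^+ t * e * p * (e' * p ^+ (n.-1 - t) * e').
Proof.
move=> ee1 ee0 conv_e; elim=> [|n IHn]; first by rewrite big_ord0 expr0 mulr1.
have ee : e * e = e by rewrite -[RHS]mulr1 -ee1 mulrDr ee0 addr0.
have -> : e * p ^+ n.+1 * e' = e * p * (e' * p ^+ n * e') + e * p * (e * p ^+ n * e').
  by rewrite -mulrDr -!mulrDl [e' + e]addrC ee1 mul1r exprS !mulrA.
rewrite big_ord_recl /= subn0 expr0 mulr1 ee IHn mulr_sumr; congr (_ + _).
apply: eq_bigr => t _; rewrite -conv_e /bump /= add1n subnS.
by rewrite !mulrA; congr (_ * p ^+ _ * _); have := ltn_ord t; lia.
Qed.

End FirstExit.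

Section MatrixPowers.
Variables (R : realType) (m : nat) (P : 'M[nat]_m).
Hypothesis classes : forall i,
  (classmates P i = [set i]%SET /\ forall n, (0 < n)%N -> (P ^+ n) i i = 0%N) \/
  (exists2 K, (0 < K)%N &
    forall k l, k \in classmates P i -> l \in classmates P i ->
    (0 < (P ^+ K) k l)%N).

Let spectrum (l : R) : Prop := eigenvalue (natmx R P) l.

Lemma growth_classmates i j : j \in classmates P i ->
  growth spectrum (fun n => (P ^+ n) i j).
Proof.
move=> ij; case: (classes i) => [[C1 Pi]|[K K0 PK]].
  left; exists 1%N => n n0; apply: etrans (Pi n n0).
  by move: ij; rewrite C1 inE => /eqP ->.
pose f (a : 'I_#|classmates P i|) := enum_val a.
have C0 : (0 < #|classmates P i|)%N by apply/card_gt0P; exists j.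
have [|l [x [l1 x0 xl fT]]] := @primitive_theta R _ (mxsub f f P) K C0 K0.
  by move=> a b; rewrite mxsub_classmates_exp mxE PK ?enum_valP.
right; exists l, 0%N; split=> //.
  by apply: (eigenvalue_classmates (x := x)) => // a; rewrite gt_eqF.
have := fT (enum_rank_in ij i) (enum_rank_in ij j).
under eq_fun do rewrite mxsub_classmates_exp mxE.
by rewrite !enum_rankK_in // classmates_refl.
Qed.

Lemma growth_exp i j : growth spectrum (fun n => (P ^+ n) i j).
Proof.
pose reach k := [set q | connect (step P) k q]%SET.
have [w] := ubnP #|reach i|; elim: w i => // w IHw i ltw.
have [ij|ij] := boolP (j \in classmates P i); first exact: growth_classmates.
pose C := classmates P i.
pose chi b q : nat := if q \in C == b then 1 else 0.
pose D (b : bool) : 'M[nat]_m := diag_mx (\row_q chi b q).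
have DAD b c A k l : (D b *m A *m D c) k l =
    chi b k * A k l * chi c l.
  by rewrite mul_mx_diag mul_diag_mx !mxE.
have chi1 b q : q \in C == b -> chi b q = 1 by rewrite /chi => ->.
have chi0 b q : q \in C != b -> chi b q = 0 by rewrite /chi => /negbTE ->.
have D1 : D true + D false = 1.
  apply/matrixP => k l; rewrite !mxE; case: (k == l) => //.
  by rewrite /chi eqb_id eqbF_neg; case: (k \in C).
have D0 : D true * D false = 0.
  apply/matrixP => k l; rewrite -[D true]mulr1 [LHS]DAD !mxE.
  by case: (k =P l) => [->|]; rewrite ?mulr0 ?mul0r // /chi; case: (l \in C).
have Dconv t : D true * P * (D true * P ^+ t * D true) = D true * P ^+ t.+1 * D true.
  apply/matrixP => k l; rewrite [RHS]DAD.
  transitivity (((D true *m P) *m (D true *m P ^+ t *m D true)) k l); first by [].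
  rewrite mxE expmxS mxE mulr_sumr mulr_suml; apply: eq_bigr => q _.
  rewrite DAD mul_diag_mx !mxE.
  have [kC|kC] := boolP (k \in C); last by rewrite !(chi0 _ k) ?mul0r // (negbTE kC).
  have [lC|lC] := boolP (l \in C); last by rewrite !(chi0 _ l) ?mulr0 // (negbTE lC).
  rewrite !(chi1 _ k) ?kC // !(chi1 _ l) ?lC // !mul1r !mulr1.
  have [qC|qC] := boolP (q \in C); first by rewrite chi1 ?qC // mul1r.
  rewrite chi0 ?(negbTE qC) // mul0r mulr0; apply/esym/eqP; rewrite -leqn0 leqNgt.
  rewrite -[_ * _]/(_ * _)%N muln_gt0; apply: contra qC => /andP[kq ql].
  exact: classmates_convex kC lC (connect1 kq) (expmx_gt0_connect ql).
have exit n : (P ^+ n) i j = (\sum_k \sum_l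
    conv (fun t => ((D true *m P ^+ t *m D true) i k * P k l)%N)
         (fun t => (D false *m P ^+ t *m D false) l j) n)%N.
  transitivity ((D true * P ^+ n * D false) i j).
    by rewrite [RHS]DAD !chi1 ?classmates_refl ?(negbTE ij) // mul1r mulr1.
  rewrite (first_exit D1 D0 Dconv) summxE.
  transitivity (\sum_(t < n) \sum_k \sum_l
      (((D true *m P ^+ t *m D true) i k * P k l) *
       (D false *m P ^+ (n.-1 - t) *m D false) l j)%N).
    apply: eq_bigr => t _; rewrite exchange_big /= [LHS]mxE; apply: eq_bigr => l _.
    by rewrite [X in X * _]mxE mulr_suml.
  rewrite exchange_big /=; apply: eq_bigr => k _.
  by rewrite exchange_big.
apply: (eq_growth (fun n => esym (exit n))).
apply: growth_sum => k _; apply: growth_sum => l _.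
have [kC|kC] := boolP (k \in C); last first.
  apply: eq_growth (growth0 _) => n; rewrite /conv big1 // => t _.
  by rewrite DAD (chi0 _ k) ?(negbTE kC) // mulr0.
have [lC|lC] := boolP (l \in C).
  apply: eq_growth (growth0 _) => n; rewrite /conv big1 // => t _.
  by rewrite !DAD (chi0 false l) ?lC // !mul0r muln0.
have [Pkl|Pkl] := posnP (P k l).
  apply: eq_growth (growth0 _) => n; rewrite /conv big1 // => t _.
  by rewrite Pkl muln0.
apply: growth_conv.
  apply: growthM; apply: eq_growth (growth_classmates kC) => n.
  by rewrite DAD !chi1 ?classmates_refl ?kC // mul1r mulr1.
have lj : growth spectrum (fun n => (P ^+ n) l j).
  apply: IHw; move: ltw; rewrite ltnS; apply: leq_trans.
  apply: proper_card; apply/properP; split.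
    apply/fintype.subsetP => q; rewrite !inE; apply: connect_trans.
    by move: kC; rewrite !inE => /andP[ik _]; exact: connect_trans ik (connect1 Pkl).
  exists i; rewrite !inE ?connect0 //; apply: contra lC => li.
  exact: classmates_convex kC (classmates_refl _ _) (connect1 Pkl) li.
by apply: eq_growth lj => n; rewrite DAD !chi1 ?(negbTE lC) ?(negbTE ij) // mul1r mulr1.
Qed.

End MatrixPowers.

Lemma theta_bigTheta (R : realType) (f : nat -> nat) (l : R) d :
  1 <= l -> theta f l d ->
  (fun n => (f n)%:R : R^o) =Theta_\oo (fun n => n%:R ^+ d * l ^+ n : R^o).
Proof.
move=> l1 [[C fC] [c c0 [N fc]]]; have C0 := dominated_ge0 fC.
rewrite eqThetaE qualifE; apply/asboolP.
exists (c, (C + 1) * 2 ^+ d); first by rewrite /= c0 mulr_gt0 ?exprn_gt0 // ltr_pwDr.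
exists (maxn N 1) => // n /=; rewrite geq_max => /andP[Nn n1].
have l0 : 0 <= l by lra.
have ln : 0 <= l ^+ n by rewrite exprn_ge0.
rewrite !ger0_norm ?mulr_ge0 ?exprn_ge0 ?ler0n //; split.
  by apply: le_trans (fc n Nn); rewrite ler_wpM2l ?(ltW c0) // ler_wpM2r // ler_natX.
apply: le_trans (fC n) _; rewrite -mulrA ler_pM //.
- by rewrite mulr_ge0 ?exprn_ge0.
- by rewrite lerDl.
by rewrite mulrA ler_wpM2r // -exprMn -natrM ler_natX //; lia.
Qed.

Lemma eigenvalue_complex (R : realType) n (A : 'M[nat]_n) (l : R) :
  eigenvalue (natmx R A) l ->
  eigenvalue (map_mx (fun k : nat => k%:R : R[i]) A) (real_complex R l).
Proof.
rewrite -(eigenvalue_map (real_complex R)).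
suff -> : map_mx (real_complex R) (natmx R A) =
    map_mx (fun k : nat => k%:R : R[i]) A by [].
by apply/matrixP => k q; rewrite [RHS]mxE [LHS]mxE [X in _ X = _]mxE rmorph_nat.
Qed.

Theorem proposition13 (R : realType) (m : nat) (M : 'M[nat]_m)
    (i j : 'I_m) (r : nat) (hr : (r < period M)%N) :
  (\forall n \near \oo, (M ^+ (period M * n + r)) i j = 0%N) \/
  (exists (lambda : R) (d : nat),
    [/\ eigenvalue (map_mx (fun k : nat => k%:R : R[i]) (M ^+ period M))
          (real_complex R lambda),
        1 <= lambda
      & (fun n : nat => ((M ^+ (period M * n + r)) i j)%:R : R^o)
          =Theta_\oo (fun n : nat => n%:R ^+ d * lambda ^+ n : R^o)]).
Proof.
have : is_period M (period M) by rewrite /period; case: ex_minnP => p /asboolP.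
case=> _ [s /primitive_block_form_classes classes].
have : growth (eigenvalue (natmx R (M ^+ period M)))
    (fun n => (M ^+ (period M * n + r)) i j).
  apply: (@eq_growth _ _ (fun n =>
    \sum_k ((M ^+ period M) ^+ n) i k * (M ^+ r) k j)%N) => [n|].
    by rewrite expmxD exprM mxE.
  by apply: growth_sum => k _; apply: growthM; exact: growth_exp.
case=> [[N MN]|]; first by left; exists N.
case=> l [d [Ml l1 MT]]; right; exists l, d; split; [|by []|exact: theta_bigTheta].
exact: eigenvalue_complex.
Qed.
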